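(* Let $K$ be a field of characteristic $p>0$ with algebraic closure $\overline K$. 1. Let $f(x)\in\overline K[x]$ be a monic nonscalar polynomial of degree $d$. Then $f(x)=(x-\nu)^d$ for some $\nu\in\overline K$ if and only if $G_f(\overline K)=\mathbb T_\nu(\overline K)$ (the same $\nu$ on both sides). 2. Let $f(x)\in K[x]$ be a monic nonscalar polynomial of degree $d$ that has a single root $\nu\in\overline K$. Then $$G_f(K)=\begin{cases}\mathbb T_\nu(K)&\text{if }\nu\in K,\\ \{e\}&\text{if }\nu\notin K.\end{cases}$$ 3. Let $f(x)\in K[x]$ be a monic nonscalar polynomial of degree $d$ that has a single root $\nu\in\overline K$. Then $f(x)=(x-\nu)^d$ for some $\nu\in K$ if and only if $G_f(K)=\mathbb T_\nu(K)$ (the same $\nu$, namely the single root of $f$, throughout).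
   Context: For a field $L$ of characteristic $p$, $\mathrm{Aut}_L(L[x])=\{\sigma_{\lambda,\mu}\mid\lambda\in L^\times,\mu\in L\}$ where $\sigma_{\lambda,\mu}(x)=\lambda x+\mu$; $e$ is its identity element. The eigengroup of $f\in L[x]$ is $G_f(L)=\{\sigma\in\mathrm{Aut}_L(L[x])\mid\sigma(f)=\lambda_\sigma f\text{ for some }\lambda_\sigma\in L^\times\}$. For $\nu\in L$, $\mathbb T_\nu(L)=\{\sigma_{\lambda,(1-\lambda)\nu}\mid\lambda\in L^\times\}$, a subgroup of $\mathrm{Aut}_L(L[x])$ isomorphic to $(L^\times,\cdot)$. ''Has a single root'' means that $f$ has exactly one distinct root in $\overline K$ (of any multiplicity). *)

(* Defs.v *)
From mathcomp Require Import all_boot all_order all_algebra.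
From mathcomp Require Import boolp classical_sets.

Set Implicit Arguments.
Unset Strict Implicit.
Unset Printing Implicit Defensive.

Import GRing.Theory.
Local Open Scope ring_scope.
Local Open Scope classical_set_scope.

Definition polyAut (L : fieldType) : set ({poly L} -> {poly L}) :=
  [set s | [/\ linear s, monoid_morphism s & bijective s]].

Arguments polyAut L : clear implicits.

(* The L-algebra endomorphism of L[x] sending x to l x + m; polyAutE checks
   that those with l != 0 are exactly the L-algebra automorphisms. *)
Definition affineSubst (L : fieldType) (l m : L) : {poly L} -> {poly L} :=
  fun f => f \Po (l *: 'X + m%:P).

Lemma polyAutE (L : fieldType) :
  polyAut L = [set s | exists l m, l != 0 /\ s = affineSubst l m].
Proof.
have homE (s : {poly L} -> {poly L}) : linear s -> monoid_morphism s ->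
    s = (fun f => f \Po s 'X).
  move=> slin [s1 sM].
  have sD f g : s (f + g) = s f + s g by rewrite -[f in LHS]scale1r slin scale1r.
  have s0 : s 0 = 0 by apply: (addrI (s 0)); rewrite -sD !addr0.
  have sZ a f : s (a *: f) = a *: s f by rewrite -[_ *: f]addr0 slin s0 addr0.
  apply: funext; elim/poly_ind => [|f c IH]; first by rewrite s0 comp_poly0.
  by rewrite sD sM IH comp_polyD comp_polyM comp_polyX comp_polyC -alg_polyC sZ s1.
apply/seteqP; split=> s /=.
  case=> slin smon [t st ts].
  have sE := homE s slin smon; set q := s 'X in sE.
  have := ts 'X; rewrite sE => /(congr1 (fun g : {poly L} => (size g).-1)).
  rewrite size_comp_poly size_polyX /= => /eqP; rewrite muln_eq1 => /andP[_ /eqP q1].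
  have szq : size q = 2 by case: (size q) q1 => [|[|[]]].
  exists q`_1, q`_0; split.
    have: lead_coef q != 0 by rewrite lead_coef_eq0 -size_poly_eq0 szq.
    by rewrite lead_coefE szq.
  apply: funext => f; congr (_ \Po _).
  apply/polyP => i; rewrite coefD coefZ coefX coefC.
  case: i => [|[|i]] /=; rewrite ?mulr0 ?mulr1 ?add0r ?addr0 //.
  by rewrite nth_default ?szq.
case=> l [m [l0 ->]]; split.
- by move=> a f g; rewrite /affineSubst comp_polyD comp_polyZ.
- by split=> [|f g]; rewrite /affineSubst ?comp_polyM // comp_polyC.
exists (affineSubst l^-1 (- (l^-1 * m))) => f; rewrite /affineSubst -comp_polyA.
  rewrite comp_polyD comp_polyZ comp_polyX comp_polyC scalerDr scalerA mulfV //.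
  rewrite scale1r -[l *: _%:P]mul_polyC -polyCM mulrN mulrA mulfV // mul1r.
  by rewrite polyCN subrK comp_polyXr.
rewrite comp_polyD comp_polyZ comp_polyX comp_polyC scalerDr scalerA mulVf //.
by rewrite scale1r -[_ *: _%:P]mul_polyC -polyCM polyCN addrK comp_polyXr.
Qed.

Definition eigengroup (L : fieldType) (f : {poly L}) :
    set ({poly L} -> {poly L}) :=
  [set s | polyAut L s /\ exists2 c : L, c != 0 & s f = c *: f].

Definition torus (L : fieldType) (nu : L) : set ({poly L} -> {poly L}) :=
  [set affineSubst l ((1 - l) * nu) | l in [set l : L | l != 0]].

Definition single_root (K Kbar : fieldType) (iota : {rmorphism K -> Kbar})
    (f : {poly K}) (nu : Kbar) : Prop :=
  forall a : Kbar, root (map_poly iota f) a <-> a = nu.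

(* Main.v *)
(* An affine substitution in the eigengroup permutes the roots of f, so it fixes
   a root that is unique; the substitutions x |-> l x + m fixing nu are exactly
   those with m = (1 - l) nu. If l != 1, such an equation puts nu in the field of
   l and m, whence triviality when nu is not in K. Conversely, torus nu is
   transitive on the points other than nu, so if it lies in the eigengroup of f,
   a root of f other than nu would make every point a root except possibly nu,
   which is absurd over an infinite field. *)
Require Import Defs.
From mathcomp Require Import all_boot all_order all_algebra.
From mathcomp Require Import boolp classical_sets.

Set Implicit Arguments.
Unset Strict Implicit.
Unset Printing Implicit Defensive.

Import GRing.Theory.
Local Open Scope ring_scope.
Local Open Scope classical_set_scope.

Lemma eigengroupP (L : fieldType) (f : {poly L}) (s : {poly L} -> {poly L}) :
  eigengroup f s <-> exists l m, [/\ l != 0, s = affineSubst l m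
    & exists2 c, c != 0 & f \Po (l *: 'X + m%:P) = c *: f].
Proof.
rewrite /eigengroup polyAutE; split.
  by case=> -[l [m [l0 ->]]] [c c0 sf]; exists l, m; split=> //; exists c.
by case=> l [m [l0 -> [c c0 sf]]]; split; [exists l, m | exists c].
Qed.

Lemma root_comp_affine (L : fieldType) (f : {poly L}) (l m c a : L) :
  f \Po (l *: 'X + m%:P) = c *: f -> root f a -> root f (l * a + m).
Proof.
move=> /(congr1 (horner^~ a)) + /rootP fa.
by rewrite horner_comp !hornerE fa mulr0 => /rootP.
Qed.

(** Mapping the eigenvector equation along [iota] lets it act on roots in [L], so the fixed-point
    equation is stated there: [nu] may lie outside the image of [K]. *)
Lemma eigengroup_fix_root (K L : fieldType) (iota : {rmorphism K -> L})
    (f : {poly K}) (nu : L) (s : {poly K} -> {poly K}) :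
  single_root iota f nu -> eigengroup f s ->
  exists l m, [/\ l != 0, s = affineSubst l m & iota l * nu + iota m = nu].
Proof.
move=> f1 /eigengroupP[l [m [l0 -> [c _ fc]]]]; exists l, m; split=> //.
apply/f1; apply: (@root_comp_affine _ _ _ _ (iota c)); last exact/f1.
move/(congr1 (map_poly iota)): fc.
by rewrite map_comp_poly rmorphD /= !map_polyZ map_polyX map_polyC.
Qed.

(** The substitution fixes the point [nu], so it multiplies ['X - nu%:P] by [l]. *)
Lemma comp_XsubC_torus (L : fieldType) (nu l : L) (d : nat) :
  (('X - nu%:P) ^+ d) \Po (l *: 'X + ((1 - l) * nu)%:P)
    = l ^+ d *: ('X - nu%:P) ^+ d.
Proof.
rewrite rmorphXn /= comp_polyB comp_polyX comp_polyC -exprZn; congr (_ ^+ _).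
rewrite scalerBr -addrA -polyCB -[l *: nu%:P]mul_polyC -polyCM -polyCN.
by congr (_ + _%:P); rewrite mulrBl mul1r addrC addKr.
Qed.

Lemma eigengroup_XsubC_exp (L : fieldType) (nu : L) (d : nat) :
  (0 < d)%N -> eigengroup (('X - nu%:P) ^+ d) = torus nu.
Proof.
case: d => // d _; apply/seteqP; split=> s /=.
  (* Taking [idfun] as the embedding makes the fixed-root lemma apply over [L] itself; the exponent
     is positive, so [nu] really is a root. *)
  have f1 : single_root idfun (('X - nu%:P) ^+ d.+1) nu.
    by move=> a; rewrite map_poly_id // root_exp_XsubC; split=> /eqP.
  case/(eigengroup_fix_root f1)=> l [m [l0 -> /= lm]]; exists l => //.
  by congr affineSubst; rewrite mulrBl mul1r -[in X in X - _]lm addrC addKr.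
case=> l /= l0 <-; apply/eigengroupP; exists l, ((1 - l) * nu); split=> //.
by exists (l ^+ d.+1); rewrite ?expf_neq0 // comp_XsubC_torus.
Qed.

(** The polynomial splits into linear factors; each factor comes from [nu], and the degree counts
    them. *)
Lemma closed_monic_one_root (F : closedFieldType) (g : {poly F}) (nu : F) d :
  g \is monic -> size g = d.+1 -> (forall a, root g a -> a = nu) ->
  g = ('X - nu%:P) ^+ d.
Proof.
move=> /monicP gm szg g1; have [r gE] := closed_field_poly_normal g.
rewrite gm scale1r in gE.
have szr : size r = d by move: szg; rewrite gE size_prod_XsubC => -[].
have rnu : all (pred1 nu) r.
  by apply/allP => a ar; apply/eqP/g1; rewrite gE root_prod_XsubC.
by rewrite gE (all_pred1P _ _ rnu) big_nseq -Monoid.iteropE szr.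
Qed.

Lemma torus_eigengroup_root (F : closedFieldType) (f : {poly F}) (nu a : F) :
  f != 0 -> (torus nu `<=` eigengroup f) -> root f a -> a = nu.
Proof.
move=> f0 sub fa; apply/eqP; apply: contraT => anu.
have an0 : a - nu != 0 by rewrite subr_eq0.
have /closed_nonrootP[y] : f * ('X - nu%:P) != 0.
  by rewrite mulf_neq0 ?polyXsubC_eq0.
rewrite rootM root_XsubC negb_or => /andP[/negP fy ynu].
(* The ratio for which the affine map fixing [nu] sends the root [a] to the nonroot [y]; it is
   nonzero because [y] differs from [nu]. *)
pose l := (y - nu) / (a - nu).
have l0 : l != 0 by rewrite mulf_neq0 ?invr_eq0 ?subr_eq0.
have [_ [c _ sf]] : eigengroup f (affineSubst l ((1 - l) * nu)).
  by apply: sub; exists l.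
case: fy; have := root_comp_affine sf fa.
suff -> : l * a + (1 - l) * nu = y by [].
by rewrite mulrBl mul1r addrCA -mulrBr divfK // addrC subrK.
Qed.

(** The identity descends from [F] to [K] because [iota] is injective on polynomials. *)
Lemma single_root_XsubC_exp (K : fieldType) (F : closedFieldType)
    (iota : {rmorphism K -> F}) (f : {poly K}) (nu0 : K) (d : nat) :
  f \is monic -> size f = d.+1 -> single_root iota f (iota nu0) ->
  f = ('X - nu0%:P) ^+ d.
Proof.
move=> fm szf f1; apply: (map_poly_inj iota).
rewrite rmorphXn /= rmorphB /= map_polyX map_polyC /=.
apply: closed_monic_one_root; rewrite ?map_monic ?size_map_poly //.
by move=> a /f1.
Qed.

Theorem proposition4p8 (p : nat) (K : fieldType) (Kbar : closedFieldType)
    (iota : {rmorphism K -> Kbar})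
    (charK : p \in [pchar K])
    (algKbar : forall u : Kbar, algebraicOver iota u) :
  [/\ forall (d : nat) (f : {poly Kbar}),
        f \is monic -> size f = d.+1 -> (0 < d)%N ->
        forall nu : Kbar,
          f = ('X - nu%:P) ^+ d <-> eigengroup f = torus nu,
      forall (d : nat) (f : {poly K}) (nu : Kbar),
        f \is monic -> size f = d.+1 -> (0 < d)%N -> single_root iota f nu ->
        (forall nu0 : K, iota nu0 = nu -> eigengroup f = torus nu0) /\
        (~ (exists nu0 : K, iota nu0 = nu) -> eigengroup f = [set idfun])
    & forall (d : nat) (f : {poly K}) (nu : Kbar),
        f \is monic -> size f = d.+1 -> (0 < d)%N -> single_root iota f nu ->
        (exists2 nu0 : K, iota nu0 = nu & f = ('X - nu0%:P) ^+ d) <->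
        (exists2 nu0 : K, iota nu0 = nu & eigengroup f = torus nu0)].
Proof.
split.
- move=> d f fm szf d0 nu; split=> [->|fT]; first exact: eigengroup_XsubC_exp.
  apply: closed_monic_one_root => // a.
  by apply: torus_eigengroup_root; rewrite ?fT ?monic_neq0.
- move=> d f nu fm szf d0 f1; split=> [nu0 nuE|nuK].
    by rewrite -nuE in f1; rewrite (single_root_XsubC_exp fm szf f1)
      eigengroup_XsubC_exp.
  apply/seteqP; split=> s /=.
    case/(eigengroup_fix_root f1)=> l [m [l0 -> lm]].
    have [l1|l1] := eqVneq l 1; last first.
      (* The unique fixed point of x |-> l x + m when [l] is not 1. *)
      case: nuK; exists (m / (1 - l)).
      have l1' : 1 - iota l != 0.
        by rewrite -(rmorph1 iota) -rmorphB fmorph_eq0 subr_eq0 eq_sym.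
      rewrite fmorph_div rmorphB rmorph1; apply/(canLR (mulfK l1')).
      by rewrite mulrBr mulr1 [nu * _]mulrC -[in X in X - _]lm addrC addKr.
    (* A translation with a fixed point is trivial: [m] is 0. *)
    move: lm; rewrite l1 rmorph1 mul1r => /(canRL (addKr _)).
    rewrite addNr => /eqP; rewrite fmorph_eq0 => /eqP ->.
    by apply: funext => g; rewrite /affineSubst scale1r addr0 comp_polyXr.
  move=> ->; apply/eigengroupP; exists 1, 0; split; first exact: oner_neq0.
    by apply: funext => g; rewrite /affineSubst scale1r addr0 comp_polyXr.
  by exists 1; rewrite ?oner_neq0 // scale1r addr0 comp_polyXr scale1r.
- move=> d f nu fm szf d0 f1; split=> -[nu0 nuE fE]; exists nu0 => //.
    by rewrite fE eigengroup_XsubC_exp.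
  (* Once [nu] comes from [nu0] in [K], being the single root forces the shape of [f]. *)
  by rewrite -nuE in f1; exact: single_root_XsubC_exp f1.
Qed.
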